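(* Let $s,l\ge1$ be integers. Let $C=\{C_1,\dots,C_s\}$ and $S=(S_1,\dots,S_l)$, where each $C_j$ and each $S_j$ is a (finite or infinite) set of distinct positive integers. Let $a=(a_1,\dots,a_s)$ be a tuple of integers, not all zero, let $b=(b_1,\dots,b_l)$ be a tuple of positive integers, and let $z=(z_1,\dots,z_s)$ and $w=(w_1,\dots,w_l)\in\mathbb{C}^l$. Let the generalized partition polynomials $WP_n(w,z)$ be defined by $$\frac{f(t,z,C,a)}{f(t,w,S,b)}=\sum_{n\ge0}WP_n(w,z)\,t^n .$$ Then for every integer $n\ge0$, $$WP_n(w,z)=\sum_{m=0}^{n}P_m(z)\,W_{n-m}(w),$$ where $P_m(z)=P_m(z,C,a)$ and $W_{m}(w)=W_{m}(w,S,b)$.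
   Context: Here $z_1,\dots,z_s$ are complex numbers (or indeterminates), and all series are formal power series in $t$. The set $\mathbb{N}$ contains $0$. For a family $C=\{C_1,\dots,C_s\}$ of sets of positive integers, a tuple of integers $a=(a_1,\dots,a_s)$ and $z=(z_1,\dots,z_s)$, let $f(t,z,C,a)=\prod_{j=1}^{s}\prod_{m\in C_j}(1-z_jt^m)^{a_j}$, a formal power series with constant term $1$. The series $f(t,w,S,b)$ is defined in the same way from $w$, $S$, $b$ and $l$. The partition polynomials $P_n(z)=P_n(z,C,a)$ are given by $P_0(z)=1$ and, for $n\ge1$, $$P_n(z)=\sum_{(k_1,\dots,k_n)\in\pi(n)}\prod_{j=1}^{n}\left[\frac{1}{k_j!}\left(\frac{\Psi_j(z)}{j}\right)^{k_j}\right],$$ where $\pi(n)=\{(k_1,\dots,k_n)\in\mathbb{N}^n : k_1+2k_2+\cdots+nk_n=n\}$ and $\Psi_n(z)=-\sum_{j=1}^{s}a_j\sum_{d\in C_j,\ d\mid n}d\,z_j^{n/d}$. Their generating function is $\sum_{n\ge0}P_n(z,C,a)t^n=f(t,z,C,a)$. The reciprocal partition polynomials $W_n(w)=W_n(w,S,b)$ are defined by $1/f(t,w,S,b)=\sum_{n\ge0}W_n(w)t^n$. *)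

(* Defs.v *)
From HB Require Import structures.
From mathcomp Require Import all_boot all_order all_algebra.
From mathcomp Require Import boolp classical_sets.

Set Implicit Arguments.
Unset Strict Implicit.
Unset Printing Implicit Defensive.

Import GRing.Theory.
Local Open Scope ring_scope.

(* [F n] is the coefficient of t^n in F; a record rather than a mere function,
   so that the Cauchy product does not clash with the pointwise product. *)
Record fps (K : Type) := Fps { fps_coef :> nat -> K }.

HB.instance Definition _ (K : Type) := gen_eqMixin (fps K).
HB.instance Definition _ (K : Type) := gen_choiceMixin (fps K).

Lemma fpsP (K : Type) (F G : fps K) : (forall n, F n = G n) <-> F = G.
Proof.
by split=> [|->//]; case: F G => [f] [g] /= /funext ->.
Qed.

Section FpsRing.
Variable K : fieldType.
Implicit Types F G H : fps K.

Definition fps_zero : fps K := Fps (fun=> 0).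
Definition fps_one : fps K := Fps (fun n => (n == 0%N)%:R).
Definition fps_opp F : fps K := Fps (fun n => - F n).
Definition fps_add F G : fps K := Fps (fun n => F n + G n).
Definition fps_mul F G : fps K :=
  Fps (fun n => \sum_(i < n.+1) F i * G (n - i)%N).

Fact fps_addA : associative fps_add.
Proof. by move=> F G H; apply/fpsP => n /=; rewrite addrA. Qed.
Fact fps_addC : commutative fps_add.
Proof. by move=> F G; apply/fpsP => n /=; rewrite addrC. Qed.
Fact fps_add0 : left_id fps_zero fps_add.
Proof. by move=> F; apply/fpsP => n /=; rewrite add0r. Qed.
Fact fps_addN : left_inverse fps_zero fps_opp fps_add.
Proof. by move=> F; apply/fpsP => n /=; rewrite addNr. Qed.

HB.instance Definition _ :=
  GRing.isZmodule.Build (fps K) fps_addA fps_addC fps_add0 fps_addN.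

Definition fps_trunc N F : {poly K} := \poly_(i < N) F i.

Fact fps_mul_trunc N F G n : (n < N)%N ->
  fps_mul F G n = (fps_trunc N F * fps_trunc N G)`_n.
Proof.
move=> nN; rewrite coefM; apply: eq_bigr => i _.
rewrite !coef_poly (leq_ltn_trans _ nN) ?(leq_ltn_trans _ nN) ?leq_subr //.
by rewrite -ltnS.
Qed.

Fact fps_mulC : commutative fps_mul.
Proof.
by move=> F G; apply/fpsP => n; rewrite !(@fps_mul_trunc n.+1) // mulrC.
Qed.

Fact fps_mulA : associative fps_mul.
Proof.
move=> F G H; apply/fpsP => n.
pose p := fps_trunc n.+1.
transitivity ((p F * (p G * p H))`_n).
  rewrite coefM [LHS]/fps_coef /fps_mul -/(fps_mul G H); apply: eq_bigr => i _.
  by rewrite (@fps_mul_trunc n.+1) ?ltnS ?leq_subr // coef_poly ltn_ord.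
rewrite mulrA coefM [RHS]/fps_coef /fps_mul -/(fps_mul F G).
apply: eq_bigr => i _.
by rewrite (@fps_mul_trunc n.+1) // [(p H)`__]coef_poly ltnS leq_subr.
Qed.

Fact fps_mul1 : left_id fps_one fps_mul.
Proof.
move=> F; apply/fpsP => n /=.
rewrite big_ord_recl /= subn0 mul1r big1 ?addr0 // => i _.
by rewrite mul0r.
Qed.

Fact fps_mulDl : left_distributive fps_mul fps_add.
Proof.
move=> F G H; apply/fpsP => n /=; rewrite -big_split /=.
by apply: eq_bigr => i _; rewrite mulrDl.
Qed.

Fact fps_one_neq0 : fps_one != 0.
Proof.
by apply/eqP => /fpsP /(_ 0%N) /eqP; rewrite /= oner_eq0.
Qed.

HB.instance Definition _ := GRing.Zmodule_isComNzRing.Build (fps K)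
  fps_mulA fps_mulC fps_mul1 fps_mulDl fps_one_neq0.

Lemma fps_coef0 n : (0 : fps K) n = 0. Proof. by []. Qed.
Lemma fps_coef1 n : (1 : fps K) n = (n == 0%N)%:R. Proof. by []. Qed.
Lemma fps_coefD F G n : (F + G) n = F n + G n. Proof. by []. Qed.
Lemma fps_coefN F n : (- F) n = - F n. Proof. by []. Qed.
Lemma fps_coefM F G n : (F * G) n = \sum_(i < n.+1) F i * G (n - i)%N.
Proof. by []. Qed.

(* The first n coefficients of 1/F, by the usual recursion. *)
Fixpoint fps_inv_seq F n : seq K :=
  if n is m.+1 then
    let s := fps_inv_seq F m in
    rcons s ((F 0%N)^-1 *
      (if m is 0 then 1 else - \sum_(i < m) F (m - i)%N * s`_i))
  else [::].

Definition fps_unit : pred (fps K) := fun F => F 0%N != 0.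

(* Junk value outside the units: F itself, as unitRingType requires. *)
Definition fps_inv F : fps K :=
  if F 0%N != 0 then Fps (fun n => (fps_inv_seq F n.+1)`_n) else F.

Fact size_fps_inv_seq F n : size (fps_inv_seq F n) = n.
Proof. by elim: n => //= n IHn; rewrite size_rcons IHn. Qed.

Fact nth_fps_inv_seq F n i : (i < n)%N ->
  (fps_inv_seq F n)`_i = (fps_inv_seq F i.+1)`_i.
Proof.
elim: n => // n IHn; rewrite ltnS leq_eqVlt => /predU1P[->//|lt_in].
by rewrite -IHn //= nth_rcons size_fps_inv_seq lt_in.
Qed.

Fact fps_mulVr : {in fps_unit, left_inverse 1 fps_inv *%R}.
Proof.
move=> F; rewrite /in_mem /= /fps_unit => F0; apply/fpsP => n.
rewrite fps_coefM fps_coef1 big_ord_recr /= subnn.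
rewrite /fps_inv F0 /= nth_rcons size_fps_inv_seq ltnn eqxx.
case: n => [|n]; first by rewrite big_ord0 add0r mulr1 mulVf.
rewrite [X in _ + X]mulrC mulVKf //.
apply/eqP; rewrite subr_eq0; apply/eqP; apply: eq_bigr => i _.
rewrite mulrC; congr (_ * _).
have /(@nth_fps_inv_seq F) -> : (i < n.+1)%N by [].
by [].
Qed.

Fact fps_unitPl F G : G * F = 1 -> fps_unit F.
Proof.
move=> /fpsP /(_ 0%N); rewrite fps_coefM big_ord1 fps_coef1 => GF.
apply/eqP => F0; move/eqP: GF.
by rewrite subnn F0 mulr0 eq_sym oner_eq0.
Qed.

Fact fps_invr_out : {in [predC fps_unit], fps_inv =1 id}.
Proof.
by move=> F; rewrite /in_mem /= /fps_unit /fps_inv negbK => ->.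
Qed.

HB.instance Definition _ := GRing.ComNzRing_hasMulInverse.Build (fps K)
  fps_mulVr fps_unitPl fps_invr_out.

Definition fps_monomial (c : K) (m : nat) : fps K :=
  Fps (fun n => if n == m then c else 0).

(* The infinite product of the u m, m >= 0, under the assumption that
   u m = 1 modulo t^m for all m: the factors with m > n then do not affect the
   coefficient of t^n, see fps_infprodE. *)
Definition fps_infprod (u : nat -> fps K) : fps K :=
  Fps (fun n => (\prod_(m < n.+1) u m) n).

Lemma fps_infprodE (u : nat -> fps K) :
    (forall m i, (i < m)%N -> u m i = (i == 0%N)%:R) ->
  forall n N, (n < N)%N -> (\prod_(m < N) u m) n = fps_infprod u n.
Proof.
move=> u1 n; elim=> // N IHN; rewrite ltnS leq_eqVlt => /predU1P[->//|ltnN].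
rewrite -IHN // big_ord_recr fps_coefM big_ord_recr subnn.
rewrite u1 ?(leq_ltn_trans _ ltnN) // mulr1 big1 => [|i _].
  exact: add0r.
rewrite u1 ?(leq_ltn_trans (leq_subr _ _)) // subn_eq0 leqNgt (ltn_ord i).
by rewrite mulr0.
Qed.

(* The series f(t, z, C, a) = prod_j prod_(m in C_j) (1 - z_j t^m)^(a_j). When
   0 is in no C_j, each 1 - z_j t^m has constant term 1, hence is a unit, so a
   negative exponent is a genuine inverse power, and fps_infprodE applies. *)
Definition prodseries (s : nat) (z : 'I_s -> K) (C : 'I_s -> set nat)
    (a : 'I_s -> int) : fps K :=
  \prod_(j < s) fps_infprod
    (fun m => if m \in C j then (1 - fps_monomial (z j) m) ^ a j else 1).

(* The case n = 0 is junk: divisors 0 is empty. *)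
Definition Psi (s : nat) (z : 'I_s -> K) (C : 'I_s -> set nat)
    (a : 'I_s -> int) (n : nat) : K :=
  - \sum_(j < s) (a j)%:~R *
      \sum_(d <- divisors n | d \in C j) d%:R * z j ^+ (n %/ d).

(* k : {ffun 'I_n -> 'I_n.+1} stands for the tuple (k_1, .., k_n), with
   k_{j+1} = k j; the equation k_1 + 2 k_2 + .. + n k_n = n forces k_j <= n,
   so the bound on the values loses nothing. *)
Definition partpoly (s : nat) (z : 'I_s -> K) (C : 'I_s -> set nat)
    (a : 'I_s -> int) (n : nat) : K :=
  if n == 0%N then 1 else
  \sum_(k : {ffun 'I_n -> 'I_n.+1} | (\sum_(j < n) j.+1 * k j)%N == n)
    \prod_(j < n) ((k j)`!%:R^-1 * (Psi z C a j.+1 / j.+1%:R) ^+ k j).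

Definition recpartpoly (l : nat) (w : 'I_l -> K) (S : 'I_l -> set nat)
    (b : 'I_l -> int) (n : nat) : K :=
  (prodseries w S b)^-1 n.

Definition genpartpoly (s l : nat) (w : 'I_l -> K) (z : 'I_s -> K)
    (C : 'I_s -> set nat) (a : 'I_s -> int)
    (S : 'I_l -> set nat) (b : 'I_l -> int) (n : nat) : K :=
  (prodseries z C a / prodseries w S b) n.

End FpsRing.

(* Main.v *)
Require Import Defs.
From mathcomp Require Import all_boot all_order all_algebra.
From mathcomp Require Import boolp classical_sets.

(** The coefficient of t^n in f(t,z,C,a) * (1/f(t,w,S,b)) is a Cauchy product,
    so everything rests on the generating function identity
    sum_n P_n(z) t^n = f(t,z,C,a) (lemma [partpoly_prodseries]).  This in turn
    says f = exp (sum_(j >= 1) Psi_j t^j / j), and it is proved by comparing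
    logarithmic derivatives with respect to the Euler operator
    theta = t d/dt, which acts on coefficients by F_n |-> n F_n.

    On the one hand, theta (1 - z t^m) / (1 - z t^m)
    = - sum_(k >= 1) m z^k t^(m k), and collecting these series over the
    factors of f gives sum_(n >= 1) Psi_n t^n: the term t^n gets a contribution from
    each m that divides n ([dlog_prodseries]).  On the other hand,
    exp (Psi_m t^m / m) has logarithmic derivative Psi_m t^m, so the product
    over m of these exponentials has the same logarithmic derivative as f
    ([dlog_infprod] passes from the factors to an infinite product).  In
    characteristic 0, two series with constant term 1 and the same logarithmic
    derivative are equal, because their quotient is killed by theta
    ([dlog_inj]).

    Finally, expanding the product of the exponential series into monomials
    yields exactly the sum over pi(n) that defines P_n ([coef_prod_expmono]). *)

Import GRing.Theory.
Local Open Scope ring_scope.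

(** * Series modulo a power of t *)

Definition fps_eqmod {K : fieldType} (m : nat) (F G : fps K) :=
  forall i, (i < m)%N -> F i = G i.

Lemma fps_eqmodM {K : fieldType} {m : nat} {F F' G G' : fps K} :
  fps_eqmod m F F' -> fps_eqmod m G G' -> fps_eqmod m (F * G) (F' * G').
Proof.
move=> FF' GG' n nm; rewrite !fps_coefM; apply: eq_bigr => i _.
rewrite FF' ?GG' //; first by rewrite (leq_ltn_trans (leq_subr _ _)).
by rewrite (leq_ltn_trans _ nm) // -ltnS.
Qed.

Lemma fps_eqmod_prod {K : fieldType} {m : nat} {I : Type} (r : seq I)
    (P : pred I) (F G : I -> fps K) :
    (forall i, P i -> fps_eqmod m (F i) (G i)) ->
  fps_eqmod m (\prod_(i <- r | P i) F i) (\prod_(i <- r | P i) G i).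
Proof.
by move=> FG; apply: (big_ind2 (fps_eqmod m)) => // ? ? ? ?; apply: fps_eqmodM.
Qed.

Lemma fps_eqmod1_unit {K : fieldType} {m : nat} {F : fps K} :
  (0 < m)%N -> fps_eqmod m F 1 -> F \is a GRing.unit.
Proof.
move=> m_gt0 F1; rewrite [_ \is a _]/(F 0%N != 0) F1 //.
by rewrite fps_coef1 oner_eq0.
Qed.

(** Multiply the congruence between F and 1 by F^-1. *)
Lemma fps_eqmod1V {K : fieldType} {m : nat} {F : fps K} :
  fps_eqmod m F 1 -> fps_eqmod m F^-1 1.
Proof.
case: m => [//|m] F1; have F_unit := fps_eqmod1_unit (ltn0Sn m) F1.
have F1' : fps_eqmod m.+1 1 F by move=> i im; rewrite F1.
have := fps_eqmodM F1' (fun i _ => erefl (F^-1 i)).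
by rewrite mul1r mulrV.
Qed.

Lemma fps_eqmod1X {K : fieldType} {m : nat} {F : fps K} (a : int) :
  fps_eqmod m F 1 -> fps_eqmod m (F ^ a) 1.
Proof.
move=> F1; have F1n n : fps_eqmod m (F ^+ n) 1.
  elim: n => [|n IHn]; first by rewrite expr0.
  by rewrite exprS -[X in fps_eqmod m _ X](mulr1 1); apply: fps_eqmodM.
by case: a => n; [apply: F1n | apply: fps_eqmod1V; apply: F1n].
Qed.

Lemma fps_coef_sum {K : fieldType} {I : Type} (r : seq I) (P : pred I)
    (F : I -> fps K) n :
  (\sum_(i <- r | P i) F i) n = \sum_(i <- r | P i) F i n.
Proof. by apply: (big_morph (fun G : fps K => G n)). Qed.

Lemma fps_coefMz {K : fieldType} (F : fps K) (a : int) n :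
  (F *~ a) n = F n *~ a.
Proof.
have coefMn k : (F *+ k) n = F n *+ k.
  by elim: k => // k; rewrite !mulrS => <-.
by case: a => k; [apply: coefMn | apply: (congr1 -%R (coefMn k.+1))].
Qed.

Lemma fps_coef_mulmono {K : fieldType} (F : fps K) (c : K) m n :
  (F * fps_monomial c m) n = if (m <= n)%N then F (n - m)%N * c else 0.
Proof.
rewrite mulrC fps_coefM; case: leqP => [le_mn|lt_nm].
  rewrite (bigD1 (Ordinal (le_mn : m < n.+1)%N)) //= eqxx big1.
    by rewrite addr0 mulrC.
  by move=> i /negPf; rewrite -val_eqE /= => ->; rewrite mul0r.
rewrite big1 // => i _ /=; case: eqP => [im|_]; last by rewrite mul0r.
by have := ltn_ord i; rewrite im ltnS leqNgt lt_nm.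
Qed.

Lemma fps_monomialM {K : fieldType} (c d : K) (m p : nat) :
  fps_monomial c m * fps_monomial d p = fps_monomial (c * d) (m + p).
Proof.
apply/fpsP => n; rewrite fps_coef_mulmono /=; case: leqP => [le_pn|lt_np].
  by rewrite -(eqn_add2r p) subnK //; case: ifP => //; rewrite mul0r.
by case: eqP => // np; move: lt_np; rewrite np ltnNge leq_addl.
Qed.

Lemma fps_monomial_prod {K : fieldType} {I : Type} (r : seq I)
    (c : I -> K) (e : I -> nat) :
  \prod_(i <- r) fps_monomial (c i) (e i) =
    fps_monomial (\prod_(i <- r) c i) (\sum_(i <- r) e i).
Proof.
elim: r => [|i r IHr]; last by rewrite !big_cons IHr fps_monomialM.
by rewrite !big_nil; apply/fpsP => n /=; case: eqP.
Qed.

(** * Logarithmic derivatives *)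

(** The derivation t d/dt is preferred to d/dt because it does not shift
    coefficients. *)
Definition fps_euler {K : fieldType} (F : fps K) : fps K :=
  Fps (fun n => n%:R * F n).

Lemma fps_eulerM {K : fieldType} (F G : fps K) :
  fps_euler (F * G) = fps_euler F * G + F * fps_euler G.
Proof.
apply/fpsP => n; rewrite fps_coefD !fps_coefM /= mulr_sumr -big_split /=.
apply: eq_bigr => i _.
rewrite mulrCA -mulrA [i%:R * _]mulrCA -mulrDr; congr (_ * _).
by rewrite -mulrDl -natrD subnKC // -ltnS.
Qed.

Lemma fps_euler1 {K : fieldType} : fps_euler (1 : fps K) = 0.
Proof. by apply/fpsP => -[|n] /=; rewrite ?mul0r ?mulr0. Qed.

(** The logarithmic derivative as a relation free of division, so that it can
    be checked on coefficients by a convolution identity. *)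
Definition is_dlog {K : fieldType} (F G : fps K) := fps_euler F = F * G.

Lemma dlog1 {K : fieldType} : is_dlog (1 : fps K) 0.
Proof. by rewrite /is_dlog fps_euler1 mulr0. Qed.

Lemma dlogM {K : fieldType} {F F' G G' : fps K} :
  is_dlog F G -> is_dlog F' G' -> is_dlog (F * F') (G + G').
Proof.
rewrite /is_dlog fps_eulerM => -> ->.
by rewrite mulrDr mulrAC mulrA.
Qed.

Lemma dlog_prod {K : fieldType} {I : Type} (r : seq I) (F G : I -> fps K) :
    (forall i, is_dlog (F i) (G i)) ->
  is_dlog (\prod_(i <- r) F i) (\sum_(i <- r) G i).
Proof.
move=> FG; elim: r => [|i r IHr]; rewrite ?big_nil ?big_cons.
  exact: dlog1.
exact: dlogM.
Qed.

(** Applying the derivation to F * F^-1 = 1 gives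
    0 = F * (G * F^-1 + theta F^-1), and F can be cancelled. *)
Lemma dlogV {K : fieldType} {F G : fps K} :
  F \is a GRing.unit -> is_dlog F G -> is_dlog F^-1 (- G).
Proof.
move=> F_unit FG; apply: (mulrI F_unit).
have := fps_eulerM F F^-1; rewrite mulrV // fps_euler1 FG.
move/esym/eqP; rewrite addrC addr_eq0 => /eqP ->.
by rewrite !mulrN mulrA mulrAC.
Qed.

Lemma dlogX {K : fieldType} {F G : fps K} (a : int) :
  F \is a GRing.unit -> is_dlog F G -> is_dlog (F ^ a) (G *~ a).
Proof.
move=> F_unit FG; have FGn n : is_dlog (F ^+ n) (G *+ n).
  elim: n => [|n IHn]; first exact: dlog1.
  by rewrite exprS mulrS; apply: dlogM.
case: a => n; first exact: FGn.
by apply: dlogV (FGn n.+1); rewrite unitrX.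
Qed.

(** The hypotheses make both the product of the u m and the sum of the g m
    converge t-adically, so that any given coefficient of the identity is one
    of the finite identity [dlog_prod]. *)
Lemma dlog_infprod {K : fieldType} (u g : nat -> fps K) :
    (forall m, fps_eqmod m (u m) 1) -> (forall m, fps_eqmod m (g m) 0) ->
    (forall m, is_dlog (u m) (g m)) ->
  is_dlog (fps_infprod u) (Fps (fun n => \sum_(m < n.+1) g m n)).
Proof.
move=> u1 g0 ug; apply/fpsP => n.
(* Up to degree n, only the first n + 1 factors matter. *)
have := dlog_prod (index_enum 'I_n.+1) (u \o val) (g \o val) (fun m => ug m).
move=> /fpsP/(_ n).
rewrite /= fps_infprodE // => ->.
apply: eq_bigr => i _; rewrite fps_infprodE //; congr (_ * _).
rewrite fps_coef_sum.
rewrite [RHS](big_ord_widen n.+1 (fun m => g m (n - i)%N)) ?ltnS ?leq_subr //.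
rewrite [RHS]big_mkcond; apply: eq_bigr => m _.
by case: ltnP => // lt_im; rewrite g0.
Qed.

(** The quotient of the two series has logarithmic derivative 0, hence is
    constant in characteristic 0. *)
Lemma dlog_inj {K : fieldType} {F H G : fps K} :
    [pchar K] =i pred0 -> fps_eqmod 1 F 1 -> fps_eqmod 1 H 1 ->
  is_dlog F G -> is_dlog H G -> F = H.
Proof.
move=> /pcharf0P charK0 F1 H1 FG HG.
have H_unit : H \is a GRing.unit by apply: fps_eqmod1_unit H1.
suff FH1 : F / H = 1 by rewrite -[F](divrK H_unit) FH1 mul1r.
have := dlogM FG (dlogV H_unit HG); rewrite subrr /is_dlog mulr0.
move=> /fpsP FH0; apply/fpsP => -[|n].
  have := fps_eqmodM F1 (fps_eqmod1V H1) 0%N isT.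
  by rewrite mulr1.
have /eqP := FH0 n.+1; rewrite /= mulf_eq0 charK0 /= => /eqP.
exact.
Qed.

(** * The product f(t,z,C,a) *)

(** This is - sum_(k >= 1) m c^k t^(m k) when m > 0. *)
Definition geomdlog {K : fieldType} (c : K) (m : nat) : fps K :=
  Fps (fun n => if (0 < n)%N && (m %| n)%N
                then - (m%:R * c ^+ (n %/ m)) else 0).

Lemma geomdlog_eqmod0 {K : fieldType} (c : K) m : fps_eqmod m (geomdlog c m) 0.
Proof.
move=> i im /=; case: ifP => // /andP[i_gt0 /(dvdn_leq i_gt0)].
by rewrite leqNgt im.
Qed.

(** Multiplying the series - sum_(k >= 1) m c^k t^(m k) by 1 - c t^m makes it
    telescope to its first term. *)
Lemma dlog_1subX {K : fieldType} (c : K) m :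
  (0 < m)%N -> is_dlog (1 - fps_monomial c m) (geomdlog c m).
Proof.
move=> m_gt0; apply/fpsP => n.
rewrite mulrBl mul1r [_ * geomdlog c m]mulrC fps_coefD fps_coefN.
rewrite fps_coef_mulmono /=.
have [/dvdnP[k ->]|m_ndvd_n] := boolP (m %| n)%N; last first.
  have -> : (n == m) = false by apply: contraNF m_ndvd_n => /eqP ->.
  have -> : (n == 0%N) = false by apply: contraNF m_ndvd_n => /eqP ->.
  rewrite andbF; case: ifP => [le_mn|_]; last by rewrite !subr0 mulr0.
  by rewrite dvdn_subl // (negPf m_ndvd_n) andbF mul0r !subr0 mulr0.
case: k => [|[|k]].
- by rewrite mul0n [(m <= _)%N]leqNgt m_gt0 mul0r subr0.
- rewrite mul1n m_gt0 leqnn subnn mul0r subr0 divnn m_gt0 eqxx.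
  by rewrite (gtn_eqF m_gt0) sub0r mulrN.
rewrite leq_pmull // mulSn addKn -mulSn !muln_gt0 m_gt0 !dvdn_mull //= !mulnK //.
have -> : (k.+2 * m == m)%N = false by rewrite -{2}[m]mul1n eqn_pmul2r.
rewrite muln_eq0 (gtn_eqF m_gt0) /=.
by rewrite subr0 mulr0 [c ^+ k.+2]exprSr mulNr mulrA subrr.
Qed.

Lemma sub1X_eqmod1 {K : fieldType} (c : K) m :
  fps_eqmod m (1 - fps_monomial c m) 1.
Proof. by move=> i im; rewrite fps_coefD fps_coefN /= (ltn_eqF im) subr0. Qed.

Lemma sum_divisors {K : fieldType} (P : pred nat) (F : nat -> K) n :
  (0 < n)%N -> \sum_(d <- divisors n | P d) F d =
    \sum_(m < n.+1) if P m && (m %| n)%N then F m else 0.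
Proof.
move=> n_gt0; rewrite -(big_mkord xpredT (fun m => if P m && (m %| n)%N then F m else 0)).
rewrite -big_mkcond /= big_mkcondl /= -[RHS]big_filter.
rewrite big_mkcond; apply: perm_big; apply: uniq_perm.
- exact: divisors_uniq.
- by rewrite filter_uniq // iota_uniq.
move=> d; rewrite mem_filter mem_index_iota -dvdn_divisors //.
by case: (boolP (d %| n)%N) => // /(dvdn_leq n_gt0); rewrite ltnS.
Qed.

(** The sum starts at n = 1: no constant term can occur in a series of the
    form theta f / f. *)
Definition Psiseries {K : fieldType} {s : nat} (z : 'I_s -> K)
    (C : 'I_s -> set nat) (a : 'I_s -> int) : fps K :=
  Fps (fun n => if n is 0 then 0 else Psi z C a n).

(** The coefficient of t^n in the logarithmic derivative of f is a sum over
    all exponents m <= n in which only the divisors of n contribute, and this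
    is the divisor sum in Psi_n. *)
Lemma dlog_prodseries {K : fieldType} {s : nat} (z : 'I_s -> K)
    (C : 'I_s -> set nat) (a : 'I_s -> int) :
    (forall j m, C j m -> (0 < m)%N) ->
  is_dlog (prodseries z C a) (Psiseries z C a).
Proof.
move=> C_pos.
pose g j m := if m \in C j then geomdlog (z j) m *~ a j else 0.
have -> : Psiseries z C a =
    \sum_(j < s) Fps (fun n => \sum_(m < n.+1) g j m n).
  apply/fpsP => n; rewrite fps_coef_sum.
  have coef_g j m : g j m n = if m \in C j then geomdlog (z j) m n *~ a j else 0.
    rewrite /g; case: ifP => // _.
    exact: fps_coefMz.
  have [n0|n_gt0] := posnP n.
    rewrite n0 big1 // => j _ /=; rewrite big_ord1 -n0 coef_g n0 /=.
    by case: ifP => // _; rewrite mul0rz.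
  have -> : Psiseries z C a n = Psi z C a n by case: n n_gt0 {coef_g} => [|n].
  rewrite /Psi -sumrN; apply: eq_bigr => j _ /=.
  rewrite sum_divisors // mulr_sumr -sumrN; apply: eq_bigr => m _.
  rewrite coef_g /= n_gt0; case: ((m : nat) \in C j) => /=; last by rewrite mulr0 oppr0.
  case: (m %| n)%N; last by rewrite mulr0 oppr0 mul0rz.
  by rewrite -[RHS]mulrzl mulrN.
apply: dlog_prod => j; apply: dlog_infprod => m.
- by case: ifP => // _; apply/fps_eqmod1X/sub1X_eqmod1.
- rewrite /g; case: ifP => // _ i im.
  by rewrite fps_coefMz geomdlog_eqmod0 // mul0rz.
rewrite /g; case: ifPn => [|_]; last exact: dlog1.
rewrite inE => /C_pos m_gt0; apply: dlogX; last exact: dlog_1subX.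
exact: fps_eqmod1_unit m_gt0 (sub1X_eqmod1 _ _).
Qed.

Lemma prodseries_eqmod1 {K : fieldType} {s : nat} (z : 'I_s -> K)
    (C : 'I_s -> set nat) (a : 'I_s -> int) :
    (forall j m, C j m -> (0 < m)%N) ->
  fps_eqmod 1 (prodseries z C a) 1.
Proof.
have prod1 : 1 = \prod_(j < s) (1 : fps K) by rewrite big1_eq.
move=> C_pos; rewrite [X in fps_eqmod _ _ X]prod1.
apply: fps_eqmod_prod => j _ [] // _ /=; rewrite big_ord1.
by case: ifP => //; rewrite inE => /C_pos.
Qed.

(** * The exponential of the series of the Psi_j t^j / j *)

(** This is exp (c t^m) when m > 0. *)
Definition expmono {K : fieldType} (c : K) (m : nat) : fps K :=
  Fps (fun n => if (m %| n)%N then (n %/ m)`!%:R^-1 * c ^+ (n %/ m) else 0).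

Lemma expmono_eqmod1 {K : fieldType} (c : K) m : fps_eqmod m (expmono c m) 1.
Proof.
move=> [|i] im /=; first by rewrite dvdn0 div0n invr1 mulr1.
by case: ifP => // /(dvdn_leq (ltn0Sn i)); rewrite leqNgt im.
Qed.

(** The identity on coefficients is k / k! = 1 / (k-1)!, which requires k to be
    invertible. *)
Lemma dlog_expmono {K : fieldType} (c : K) m :
    [pchar K] =i pred0 -> (0 < m)%N ->
  is_dlog (expmono c m) (fps_monomial (m%:R * c) m).
Proof.
move=> /pcharf0P charK0 m_gt0; apply/fpsP => n; rewrite fps_coef_mulmono /=.
have [/dvdnP[k ->]|m_ndvd_n] := boolP (m %| n)%N; last first.
  rewrite mulr0; case: ifP => // le_mn.
  by rewrite dvdn_subl // (negPf m_ndvd_n) mul0r.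
case: k => [|k]; first by rewrite mul0n leqNgt m_gt0 mul0r.
rewrite leq_pmull // mulSn addKn -mulSn dvdn_mull // !mulnK //.
have k_neq0 : k.+1%:R != 0 :> K by rewrite charK0.
rewrite factS !natrM invfM exprSr -[_^-1 / _ * _]mulrA mulrACA mulfV // mul1r.
by rewrite mulrCA -[RHS]mulrA; congr (_ * _); apply: mulrCA.
Qed.

(** Distributing the product over the sums, a monomial of degree n amounts to
    a choice, for each part size j, of the multiplicity k_j of j in a partition
    of n. *)
Lemma coef_prod_expmono {K : fieldType} (c : nat -> K) n :
  (\prod_(j < n) expmono (c j.+1) j.+1) n =
  \sum_(k : {ffun 'I_n -> 'I_n.+1} | (\sum_(j < n) j.+1 * k j)%N == n)
    \prod_(j < n) ((k j)`!%:R^-1 * c j.+1 ^+ k j).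
Proof.
pose e (j k : nat) := fps_monomial (k`!%:R^-1 * c j.+1 ^+ k) (j.+1 * k).
(* Terms of index k > n in the exponential series have degree > n. *)
rewrite (_ : _ n = (\prod_(j < n) \sum_(k < n.+1) e j k) n); last first.
  apply: (fps_eqmod_prod (m := n.+1)) (ltnSn n) => j _ i le_in.
  rewrite fps_coef_sum /=.
  have [/dvdnP[k def_i]|ndvd] := boolP (j.+1 %| i)%N; last first.
    rewrite big1 // => k _; case: eqP => // def_i.
    by rewrite def_i dvdn_mulr in ndvd.
  have lt_kn : (k < n.+1)%N by rewrite (leq_ltn_trans _ le_in) // def_i leq_pmulr.
  rewrite (bigD1 (Ordinal lt_kn)) //= def_i mulnK // mulnC eqxx big1 ?addr0 //.
  move=> k' /negPf; rewrite -val_eqE /= eqn_pmul2l // eq_sym => ->.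
  by [].
rewrite bigA_distr_bigA fps_coef_sum [RHS]big_mkcond; apply: eq_bigr => k _.
by rewrite fps_monomial_prod /= eq_sym.
Qed.

(** P_n is the coefficient of t^n in the product over m >= 1 of the series
    exp (Psi_m t^m / m), which has the logarithmic derivative of f. *)
Lemma partpoly_prodseries {K : fieldType} {s : nat} (z : 'I_s -> K)
    (C : 'I_s -> set nat) (a : 'I_s -> int) :
    [pchar K] =i pred0 -> (forall j m, C j m -> (0 < m)%N) ->
  Fps (partpoly z C a) = prodseries z C a.
Proof.
move=> charK0 C_pos.
pose c m := Psi z C a m / m%:R.
(* The index m = 0 of the infinite product carries a trivial factor. *)
pose u m := if m is 0 then 1 else expmono (c m) m.
have u1 m : fps_eqmod m (u m) 1.
  by case: m => // m; apply: expmono_eqmod1.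
have -> : Fps (partpoly z C a) = fps_infprod u.
  apply/fpsP => n; rewrite /= big_ord_recl mul1r coef_prod_expmono /partpoly.
  case: eqP => // ->; rewrite (big_pred1 [ffun=> ord0]).
    by rewrite big_ord0.
  move=> k; rewrite big_ord0; apply/esym/eqP/ffunP => -[].
  by [].
pose g m := if m is 0 then 0 else fps_monomial (Psi z C a m) m.
apply: (dlog_inj charK0 _ (prodseries_eqmod1 z C a C_pos) _
  (dlog_prodseries z C a C_pos)).
  by move=> [] // _; rewrite /= big_ord1.
suff -> : Psiseries z C a = Fps (fun n => \sum_(m < n.+1) g m n).
  apply: dlog_infprod => // -[|m] //.
  - by move=> i im /=; rewrite ltn_eqF.
  - exact: dlog1.
  have m_neq0 : m.+1%:R != 0 :> K by move/pcharf0P: charK0 => ->.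
  by have := dlog_expmono (c m.+1) m.+1 charK0 isT; rewrite [_ * c _]mulrC divfK.
apply/fpsP => n /=; rewrite big_ord_recr big1 /=.
  by rewrite add0r; case: n => [|n] //=; rewrite eqxx.
by move=> [[|i] lt_in] _ //=; rewrite gtn_eqF.
Qed.

(* K = C is the case of complex z and w; K = C(z_1, .., z_s) is the case where
   the z_j are indeterminates. *)
Theorem corollary4p1 (K : fieldType) (charK0 : [pchar K] =i pred0)
    (s l : nat) (s_gt0 : (0 < s)%N) (l_gt0 : (0 < l)%N)
    (C : 'I_s -> set nat) (S : 'I_l -> set nat)
    (C_pos : forall (j : 'I_s) (m : nat), C j m -> (0 < m)%N)
    (S_pos : forall (j : 'I_l) (m : nat), S j m -> (0 < m)%N)
    (a : 'I_s -> int) (a_neq0 : exists j : 'I_s, a j != 0)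
    (b : 'I_l -> int) (b_gt0 : forall j : 'I_l, 0 < b j)
    (z : 'I_s -> K) (w : 'I_l -> K) (n : nat) :
  genpartpoly w z C a S b n =
    \sum_(0 <= m < n.+1) partpoly z C a m * recpartpoly w S b (n - m)%N.
Proof.
by rewrite big_mkord /genpartpoly -partpoly_prodseries.
Qed.
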